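(* Let $A>0$, $r_1>0$, $\rho_0>0$, $U_{10}<0$, $U_{20}\in\mathbb{R}$. For $0<r_0<r_1$ consider the problem of finding $(\rho,U_1,U_2)$ with $$\frac{d}{dr}(\rho U_1)+\frac1r\rho U_1=0,\qquad \rho U_1U_1'-\frac{\rho U_2^2}{r}+A\rho'=0,\qquad U_1U_2'+\frac{U_1U_2}{r}=0,\qquad r_0<r<r_1,$$ $$\rho(r_1)=\rho_0,\qquad U_1(r_1)=U_{10},\qquad U_2(r_1)=U_{20}.$$ For the given incoming flow at the outer circle $r=r_1$, there exists a limiting circle $r=r^\sharp$ with $r^\sharp<r_1$, depending only on $r_1$ and the incoming flow state at $r_1$, such that the flow develops singularities when $r\to r^\sharp$, in the sense that if $r_0<r^\sharp$ there does not exist any global $C^1$-smooth solution to the problem in $\Omega$. If $r_0\ge r^\sharp$, there exists a smooth solution to the problem in $\Omega$, and the flow pattern in $\Omega$ can be divided into the following cases. (i) Suppose that $M_1^2(r_1)>1$ or $|\mathbf{M}|^2(r_1)>1>M_1^2(r_1)$. Then there exists a unique smooth supersonic solution to the problem in $\Omega$. (ii) Suppose that $|\mathbf{M}|^2(r_1)<1$. Then there exists a constant $r_s$ with $0<r_s<r_1$, given by $$r_s=\sqrt{\frac{m_1^2+m_2^2\rho_s^2}{2(B_0-A\ln\rho_s)\rho_s^2}},$$ which depends only on $r_1$ and the incoming flow, such that (1) if $r_0>r_s$, there exists a unique smooth subsonic solution in $\Omega$; (2) if $r_0<r_s$, there exists a unique smooth transonic solution in $\Omega$; (3) if $r_0=r_s$,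 there exists a unique smooth subsonic-sonic solution in $\Omega$, with sonic circle located at $r=r_s$.
   Context: The equations are those of radially symmetric steady isothermal Euler flow (pressure $p=A\rho$, sound speed $\sqrt{A}$) in the annulus $\Omega=\{(x_1,x_2): r_0<r=\sqrt{x_1^2+x_2^2}<r_1\}$; $\rho>0$ is the density, and $U_1$, $U_2$ are the radial and angular velocities, all functions of $r$; the fluid enters at the outer circle $r=r_1$ and moves inward. Mach numbers: $M_i^2=U_i^2/A$ for $i=1,2$, and $|\mathbf{M}|^2=M_1^2+M_2^2$. The flow is supersonic at $r$ if $|\mathbf{M}|^2(r)>1$, sonic if $|\mathbf{M}|^2(r)=1$, subsonic if $|\mathbf{M}|^2(r)<1$. A solution is supersonic (subsonic) in $\Omega$ if it is so throughout $\Omega$; transonic if it has both a supersonic and a subsonic region in $\Omega$; subsonic-sonic if it is subsonic in $\Omega$ and sonic at $r=r_0$. Constants: $m_1=r_1\rho_0U_{10}$, $m_2=r_1U_{20}$, $B_0=\frac12(U_{10}^2+U_{20}^2)+A\ln\rho_0$, $\rho_s=\exp\left(\frac{B_0}{A}-\frac12\right)$.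
   Formalization: The formal theorem additionally assumes $M_1^2(r_1)\ne 1$: if $M_1^2(r_1)=1$, no $C^1$ solution exists for any $r_0<r_1$, so no limiting circle $r^\sharp<r_1$ with the stated property exists; none of the listed cases is affected. *)

(* Defs.v *)
From Stdlib Require Import Reals.
From Coquelicot Require Import Coquelicot.
Open Scope R_scope.

Record flow := mkFlow { rho : R -> R; U1 : R -> R; U2 : R -> R }.

Definition C1_in (r0 r1 : R) (f : R -> R) : Prop :=
  forall r, r0 < r < r1 -> ex_derive f r /\ continuous (Derive f) r.

Definition Cinf_in (r0 r1 : R) (f : R -> R) : Prop :=
  forall (n : nat) r, r0 < r < r1 -> ex_derive_n f n r.

Definition left_continuous (f : R -> R) (r : R) : Prop :=
  filterlim f (at_left r) (locally (f r)).

Definition right_continuous (f : R -> R) (r : R) : Prop :=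
  filterlim f (at_right r) (locally (f r)).

(** [Derive] is total, so it is meaningful in the equations only together with
    the C^1 clauses of [C1_solution]. *)
Definition euler_equations (A r0 r1 : R) (u : flow) : Prop :=
  forall r, r0 < r < r1 ->
    Derive (fun s => rho u s * U1 u s) r + / r * (rho u r * U1 u r) = 0 /\
    rho u r * U1 u r * Derive (U1 u) r - rho u r * U2 u r ^ 2 / r
      + A * Derive (rho u) r = 0 /\
    U1 u r * Derive (U2 u) r + U1 u r * U2 u r / r = 0.

(** The equations hold in the open annulus and the data on the outer circle are
    attained continuously; nothing is required at the inner circle r = r0. *)
Definition C1_solution (A r1 rho0 U10 U20 r0 : R) (u : flow) : Prop :=
  (C1_in r0 r1 (rho u) /\ C1_in r0 r1 (U1 u) /\ C1_in r0 r1 (U2 u)) /\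
  (left_continuous (rho u) r1 /\ left_continuous (U1 u) r1 /\
   left_continuous (U2 u) r1) /\
  (forall r, r0 < r < r1 -> 0 < rho u r) /\
  euler_equations A r0 r1 u /\
  (rho u r1 = rho0 /\ U1 u r1 = U10 /\ U2 u r1 = U20).

(** Only continuity is asked at r = r0: at the limiting circle the derivatives
    of the flow blow up. It gives a meaning to the state of the flow at r0. *)
Definition smooth_solution (A r1 rho0 U10 U20 r0 : R) (u : flow) : Prop :=
  C1_solution A r1 rho0 U10 U20 r0 u /\
  (Cinf_in r0 r1 (rho u) /\ Cinf_in r0 r1 (U1 u) /\ Cinf_in r0 r1 (U2 u)) /\
  (right_continuous (rho u) r0 /\ right_continuous (U1 u) r0 /\
   right_continuous (U2 u) r0).

(** Squared Mach number of a velocity component [v]. *)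
Definition mach2 (A v : R) : R := v ^ 2 / A.

(** |M|^2 (r) *)
Definition total_mach2 (A : R) (u : flow) (r : R) : R :=
  mach2 A (U1 u r) + mach2 A (U2 u r).

Definition supersonic (A r0 r1 : R) (u : flow) : Prop :=
  forall r, r0 < r < r1 -> 1 < total_mach2 A u r.

Definition subsonic (A r0 r1 : R) (u : flow) : Prop :=
  forall r, r0 < r < r1 -> total_mach2 A u r < 1.

Definition transonic (A r0 r1 : R) (u : flow) : Prop :=
  (exists r, r0 < r < r1 /\ 1 < total_mach2 A u r) /\
  (exists r, r0 < r < r1 /\ total_mach2 A u r < 1).

Definition subsonic_sonic (A r0 r1 : R) (u : flow) : Prop :=
  subsonic A r0 r1 u /\ total_mach2 A u r0 = 1.

(** A smooth solution of type [P] exists, and every C^1 solution, of whatever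
    type, coincides with it. *)
Definition exists_unique_smooth (A r1 rho0 U10 U20 r0 : R)
    (P : flow -> Prop) : Prop :=
  exists u, smooth_solution A r1 rho0 U10 U20 r0 u /\ P u /\
    forall v, C1_solution A r1 rho0 U10 U20 r0 v ->
      forall r, r0 < r <= r1 ->
        rho v r = rho u r /\ U1 v r = U1 u r /\ U2 v r = U2 u r.

Definition m1 (r1 rho0 U10 : R) : R := r1 * rho0 * U10.

Definition m2 (r1 U20 : R) : R := r1 * U20.

Definition B0 (A rho0 U10 U20 : R) : R :=
  / 2 * (U10 ^ 2 + U20 ^ 2) + A * ln rho0.

Definition rho_s (A rho0 U10 U20 : R) : R :=
  exp (B0 A rho0 U10 U20 / A - / 2).

Definition r_s (A r1 rho0 U10 U20 : R) : R :=
  let rs := rho_s A rho0 U10 U20 in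
  sqrt ((m1 r1 rho0 U10 ^ 2 + m2 r1 U20 ^ 2 * rs ^ 2)
        / (2 * (B0 A rho0 U10 U20 - A * ln rs) * rs ^ 2)).

(* Main.v *)
(** Mass, angular momentum and Bernoulli's law make r rho U1, r U2 and
    (U1^2 + U2^2)/2 + A ln rho constant. Eliminating rho and U2, the logarithm t
    of the squared radial Mach number satisfies
      exp t - t = c + 2 ln r - b / r^2   with b = m2^2 / A.
    The left side is convex with minimum 1 at t = 0 and the right side increases
    with r, so the limiting circle is where the right side equals 1: inside it
    there is no solution, outside it t moves towards 0 along the branch t > 0 or
    t < 0 fixed by the incoming flow, which it can leave nowhere else. On the
    branch t < 0 the total |M|^2 = exp t + b / r^2 decreases strictly in r, which
    gives the classification; the state of density rho_s placed at r_s satisfies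
    the same equation and is exactly sonic. *)

Require Import Defs.
From Stdlib Require Import Reals Lra Psatz.
From Coquelicot Require Import Coquelicot.
Open Scope R_scope.

(** * The function exp t - t and its inverse branches *)

Definition Phi (t : R) : R := exp t - t.

Lemma Phi_0 : Phi 0 = 1.
Proof. unfold Phi; rewrite exp_0; ring. Qed.

Lemma Phi_ge1 (t : R) : 1 <= Phi t.
Proof. unfold Phi; generalize (exp_ineq1_le t); lra. Qed.

Lemma sign_cases (e : R) : e * e = 1 -> e = 1 \/ e = -1.
Proof.
  intros he; assert (h : (e - 1) * (e + 1) = 0) by lra.
  apply Rmult_integral in h; lra.
Qed.

(** The sign [e] treats both half-lines at once: [e = 1] is the branch [t >= 0], [e = -1] the branch
    [t <= 0]. The inequality [1 + z < exp z] at [z = e * (y - x)] bounds the increment of [Phi]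
    strictly below by [(y - x) * (e * (exp (e * x) - 1))], whose factors are nonnegative. *)
Lemma Phi_monotone_branch (e x y : R) :
  e * e = 1 -> 0 <= x < y -> Phi (e * x) < Phi (e * y).
Proof.
  intros he [hx hxy]; unfold Phi.
  assert (h1 : 1 + e * (y - x) < exp (e * (y - x))) by (apply exp_ineq1, Rmult_integral_contrapositive_currified; nra).
  replace (e * y) with (e * x + e * (y - x)) at 1 by ring.
  rewrite exp_plus.
  assert (hp := exp_pos (e * x)).
  assert (hc : 0 <= e * (exp (e * x) - 1)).
  { destruct (sign_cases e he) as [-> | ->].
    - generalize (exp_ineq1_le (1 * x)); lra.
    - assert (exp (-1 * x) <= exp 0); [|rewrite exp_0 in *; lra].
      destruct (Req_dec x 0) as [->|]; [right; f_equal; ring|].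
      left; apply exp_increasing; lra. }
  nra.
Qed.

Lemma Phi_branch_inj (e x y : R) :
  e * e = 1 -> 0 <= x -> 0 <= y -> Phi (e * x) = Phi (e * y) -> x = y.
Proof.
  intros he hx hy h.
  destruct (Rtotal_order x y) as [l | [l | l]]; [| exact l |].
  - assert (Phi (e * x) < Phi (e * y)) by (apply Phi_monotone_branch; lra); lra.
  - assert (Phi (e * y) < Phi (e * x)) by (apply Phi_monotone_branch; lra); lra.
Qed.

(** The [sig] form lets the inverse branch be defined by projection, with no choice principle. *)
Lemma Phi_branch_onto (e K : R) :
  e * e = 1 -> 1 <= K -> {x : R | 0 <= x /\ Phi (e * x) = K}.
Proof.
  intros he hK.
  assert (hc : continuity (fun x => Phi (e * x))) by (unfold Phi; reg).
  assert (h0 : Phi (e * 0) = 1) by (rewrite Rmult_0_r; apply Phi_0).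
  (* For [e = 1], [exp (4 * K) >= (1 + 2 * K) ^ 2 >= 5 * K]; for [e = -1] the linear term alone
     contributes [4 * K]. *)
  assert (h4 : K <= Phi (e * (4 * K))).
  { unfold Phi.
    replace (e * (4 * K)) with (e * (2 * K) + e * (2 * K)) at 1 by ring.
    rewrite exp_plus.
    destruct (sign_cases e he) as [-> | ->].
    - generalize (exp_ineq1_le (1 * (2 * K))); nra.
    - generalize (exp_pos (-1 * (2 * K))); nra. }
  destruct (IVT_gen _ 0 (4 * K) K hc) as [x [hx hxK]].
  - rewrite h0, Rmin_left, Rmax_right; lra.
  - rewrite Rmin_left in hx by lra. exists x; lra.
Qed.

(* Extending the inverse branch by 0 below the minimum value 1 of [Phi] makes it
   continuous on the whole line. *)
Definition inverse_branch (e : R) (h : R -> R) : Prop :=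
  forall K, 0 <= h K /\ Phi (e * h K) = Rmax 1 K.

Lemma inverse_branch_exists (e : R) :
  e * e = 1 -> exists h, inverse_branch e h.
Proof.
  intros he.
  exists (fun K => proj1_sig (Phi_branch_onto e (Rmax 1 K) he (Rmax_l 1 K))).
  intros K; destruct Phi_branch_onto as [x hx]; exact hx.
Qed.

Lemma inverse_branch_unique (e x : R) (h : R -> R) :
  e * e = 1 -> inverse_branch e h -> 0 <= x -> h (Phi (e * x)) = x.
Proof.
  intros he hh hx; destruct (hh (Phi (e * x))) as [h0 h1].
  apply (Phi_branch_inj e); auto.
  rewrite h1; apply Rmax_right, Phi_ge1.
Qed.

(** The bound [1 < Phi (e * x)] excludes [x = 0], where [h K = 0] for every [K < 1] and the
    inequality is not strict. *)
Lemma inverse_branch_lt (e K x : R) (h : R -> R) :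
  e * e = 1 -> inverse_branch e h -> 0 <= x -> K < Phi (e * x) -> 1 < Phi (e * x) ->
  h K < x.
Proof.
  intros he hh hx hK h1; destruct (hh K) as [h0 h2].
  destruct (Rlt_or_le (h K) x) as [l | [l | l]]; auto; exfalso.
  - assert (Phi (e * x) < Phi (e * h K)) by (apply Phi_monotone_branch; lra).
    assert (Rmax 1 K < Phi (e * x)) by (apply Rmax_lub_lt; lra). lra.
  - assert (Rmax 1 K < Phi (e * x)) by (apply Rmax_lub_lt; lra). subst x; lra.
Qed.

Lemma inverse_branch_gt (e K x : R) (h : R -> R) :
  e * e = 1 -> inverse_branch e h -> 0 <= x -> Phi (e * x) < K -> x < h K.
Proof.
  intros he hh hx hK; destruct (hh K) as [h0 h2].
  assert (hR := Rmax_r 1 K).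
  destruct (Rlt_or_le x (h K)) as [l | [l | l]]; auto; exfalso.
  - assert (Phi (e * h K) < Phi (e * x)) by (apply Phi_monotone_branch; lra). lra.
  - subst x; lra.
Qed.

(** Monotonicity suffices: the values of [Phi] at [e * (h K + eps)] and [e * (h K - eps)] bound a
    neighbourhood of [K] that [h] maps within [eps] of [h K]. *)
Lemma inverse_branch_continuous (e K : R) (h : R -> R) :
  e * e = 1 -> inverse_branch e h -> continuous h K.
Proof.
  intros he hh; apply filterlim_locally; intros eps.
  assert (heps := cond_pos eps); destruct (hh K) as [h0 h2].
  assert (hR := Rmax_r 1 K). assert (hL := Rmax_l 1 K).
  assert (hup : locally K (fun y => h y < h K + eps)).
  { assert (Phi (e * h K) < Phi (e * (h K + eps)))
      by (apply Phi_monotone_branch; lra).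
    apply filter_imp with (fun y => y < Phi (e * (h K + eps))).
    - intros y hy; apply (inverse_branch_lt e); auto; lra.
    - apply open_lt; lra. }
  assert (hlo : locally K (fun y => h K - eps < h y)).
  (* When [h K < eps] the sign of [h] is enough; this includes the flat part [K <= 1], where
     [h K = 0]. *)
  { destruct (Rlt_or_le (h K - eps) 0) as [l | l].
    - apply filter_forall; intros y; destruct (hh y); lra.
    - assert (h3 : Phi (e * (h K - eps)) < Phi (e * h K))
        by (apply Phi_monotone_branch; lra).
      assert (h4 : Phi (e * (h K - eps)) < K).
      { unfold Rmax in h2; destruct (Rle_dec 1 K); [lra|].
        generalize (Phi_ge1 (e * (h K - eps))); lra. }
      apply filter_imp with (fun y => Phi (e * (h K - eps)) < y).
      + intros y hy; apply (inverse_branch_gt e); auto.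
      + apply open_gt; lra. }
  generalize (filter_and _ _ hup hlo); apply filter_imp; intros y [hy1 hy2].
  change (Rabs (h y - h K) < eps); apply Rabs_def1; lra.
Qed.

(** With [u] the increment of [h] for the step [k], the ratio [q = k / u] is a difference quotient
    of [g] at [h y]. Continuity of [h] makes [u] small, so [q] is close to [d] and [u / k] to
    [/ d]. *)
Lemma is_derive_inverse (g h : R -> R) (y d : R) :
  d <> 0 -> is_derive g (h y) d -> continuous h y ->
  locally y (fun z => g (h z) = z) -> is_derive h y (/ d).
Proof.
  intros hd hg hh hgh.
  apply is_derive_Reals; apply is_derive_Reals in hg; intros eps heps.
  set (D := Rabs d).
  assert (hD : 0 < D) by (apply Rabs_pos_lt; auto).
  (* The first bound keeps [Rabs q] above [D / 2]; the second then makes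
     [Rabs (q - d) / (Rabs q * D)] smaller than [eps]. *)
  set (eta := Rmin (D / 2) (eps * (D * D / 2))).
  assert (hDD : 0 < D * D / 2) by nra.
  assert (heta : 0 < eta) by (apply Rmin_pos; [lra | apply Rmult_lt_0_compat; auto]).
  destruct (hg eta heta) as [del hdel].
  assert (hgy := locally_singleton _ _ hgh).
  destruct (proj1 (filterlim_locally _ _) hh del) as [d1 h1].
  destruct hgh as [d2 h2].
  exists (mkposreal _ (Rmin_pos _ _ (cond_pos d1) (cond_pos d2))).
  intros k hk hk2; simpl in hk2.
  assert (hk1 : Rabs k < d1) by (eapply Rlt_le_trans; [exact hk2 | apply Rmin_l]).
  assert (hk3 : Rabs k < d2) by (eapply Rlt_le_trans; [exact hk2 | apply Rmin_r]).
  assert (ha : g (h (y + k)) = y + k).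
  { apply h2; change (Rabs (y + k - y) < d2).
    replace (y + k - y) with k by ring; exact hk3. }
  assert (hb : Rabs (h (y + k) - h y) < del).
  { apply h1; change (Rabs (y + k - y) < d1).
    replace (y + k - y) with k by ring; exact hk1. }
  set (u := h (y + k) - h y) in *.
  assert (hu : u <> 0).
  { intros hu; apply hk.
    assert (h (y + k) = h y) by (unfold u in hu; lra). rewrite H in ha; lra. }
  specialize (hdel u hu hb).
  replace (h y + u) with (h (y + k)) in hdel by (unfold u; ring).
  rewrite ha, hgy in hdel.
  replace (y + k - y) with k in hdel by ring.
  set (q := k / u) in *.
  assert (hq : q <> 0).
  { unfold q, Rdiv; apply Rmult_integral_contrapositive_currified; auto.
    apply Rinv_neq_0_compat; auto. }
  assert (e1 := Rmin_l (D / 2) (eps * (D * D / 2))).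
  assert (e2 := Rmin_r (D / 2) (eps * (D * D / 2))). fold eta in e1, e2.
  assert (hqD : D / 2 < Rabs q).
  { assert (D <= Rabs q + Rabs (q - d)); [|lra].
    unfold D. replace d with (q + - (q - d)) at 1 by ring.
    eapply Rle_trans; [apply Rabs_triang|]. rewrite Rabs_Ropp; lra. }
  replace (u / k - / d) with (- ((q - d) * / (q * d)))
    by (unfold q; field; repeat split; auto).
  rewrite Rabs_Ropp, Rabs_mult, Rabs_inv, Rabs_mult; fold D.
  apply Rmult_lt_reg_r with (Rabs q * D); [nra|].
  rewrite Rmult_assoc, Rinv_l by nra.
  assert (D * D / 2 < Rabs q * D) by nra. nra.
Qed.

(** The slope of [Phi (e * x)] vanishes only at [x = 0], that is at the level [K = 1], which the
    strict hypothesis avoids. This is where the derivatives of the flow blow up. *)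
Lemma inverse_branch_derive (e K : R) (h : R -> R) :
  e * e = 1 -> inverse_branch e h -> 1 < K ->
  0 < h K /\ 0 < e * (exp (e * h K) - 1) /\
  is_derive h K (/ (e * (exp (e * h K) - 1))).
Proof.
  intros he hh hK.
  assert (hpos : 0 < h K).
  { apply (inverse_branch_gt e); auto; [lra|]. rewrite Rmult_0_r, Phi_0; exact hK. }
  assert (hd : 0 < e * (exp (e * h K) - 1)).
  { destruct (sign_cases e he) as [-> | ->].
    - generalize (exp_ineq1 (1 * h K)); lra.
    - assert (exp (-1 * h K) < exp 0); [|rewrite exp_0 in *; lra].
      apply exp_increasing; lra. }
  split; [exact hpos | split; [exact hd|]].
  apply (is_derive_inverse (fun x => Phi (e * x))).
  - lra.
  - unfold Phi; auto_derive; auto; ring.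
  - apply (inverse_branch_continuous e); auto.
  - apply filter_imp with (fun z => 1 < z).
    + intros z hz; destruct (hh z) as [_ ->]; apply Rmax_right; lra.
    + apply open_gt; lra.
Qed.

(** * The level function and the limiting circle *)

(* The value of [Phi] at the logarithm of the squared radial Mach number. *)
Definition head (c b r : R) : R := c + 2 * ln r - b / r ^ 2.

Lemma head_derive (c b r : R) :
  0 < r -> is_derive (head c b) r (2 / r + 2 * b / r ^ 3).
Proof.
  intros hr; unfold head; auto_derive.
  - repeat split; auto; nra.
  - field; lra.
Qed.

Lemma inv_sqr_le (b r s : R) : 0 <= b -> 0 < r <= s -> b / s ^ 2 <= b / r ^ 2.
Proof.
  intros hb hrs; unfold Rdiv; apply Rmult_le_compat_l; auto.
  apply Rinv_le_contravar; nra.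
Qed.

Lemma head_increasing (c b r s : R) :
  0 <= b -> 0 < r < s -> head c b r < head c b s.
Proof.
  intros hb hrs; unfold head.
  assert (b / s ^ 2 <= b / r ^ 2) by (apply inv_sqr_le; lra).
  assert (ln r < ln s) by (apply ln_increasing; lra). lra.
Qed.

Lemma head_level (c b r1 : R) :
  0 <= b -> 0 < r1 -> 1 < head c b r1 -> exists r, 0 < r < r1 /\ head c b r = 1.
Proof.
  intros hb hr1 h1.
  (* This radius cancels [c + 2 * ln a], so that only [- b / a ^ 2 <= 0] remains. *)
  set (a := exp (- c / 2)).
  assert (ha : 0 < a) by apply exp_pos.
  assert (hha : head c b a <= 0).
  { unfold head, a at 1; rewrite ln_exp.
    assert (0 <= b / a ^ 2) by (apply Rdiv_le_0_compat; nra). lra. }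
  assert (har : a < r1).
  { destruct (Rlt_or_le a r1) as [l | [l | l]]; auto; exfalso.
    - assert (head c b r1 < head c b a) by (apply head_increasing; lra). lra.
    - subst r1; lra. }
  assert (hcont : forall x, a <= x <= r1 -> continuity_pt (fun r => head c b r - 1) x).
  { intros x hx; apply continuity_pt_filterlim.
    apply (ex_derive_continuous (fun r => head c b r - 1)).
    eexists; apply (is_derive_minus (head c b) (fun _ => 1)).
    - apply head_derive; lra.
    - apply @is_derive_const. }
  destruct (Ranalysis5.IVT_interv (fun r => head c b r - 1) a r1 hcont har)
    as [z [hz hz1]]; [lra | lra |].
  exists z; split; [split; [lra|] | lra].
  destruct (Req_dec z r1) as [->|]; lra.
Qed.

(** * Smoothness along a branch *)

(** Carrying derivatives as witnesses gives closure under the algebraic operations by plain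
    induction, without rewriting iterated [Derive]. The last derivative need not be continuous. *)
Fixpoint C_n (a b : R) (n : nat) (f : R -> R) : Prop :=
  match n with
  | O => True
  | S n => exists f', (forall r, a < r < b -> is_derive f r (f' r)) /\ C_n a b n f'
  end.

Lemma locally_interval (a b r : R) : a < r < b -> locally r (fun s => a < s < b).
Proof.
  intros hr; apply (open_and (fun s => a < s) (fun s => s < b));
    [apply open_gt | apply open_lt | exact hr].
Qed.

Lemma C_n_pred (a b : R) (n : nat) (f : R -> R) : C_n a b (S n) f -> C_n a b n f.
Proof.
  revert f; induction n as [|n IH]; intros f; [easy|].
  intros [f' [h1 h2]]; exists f'; split; [exact h1 | apply IH; exact h2].
Qed.

Lemma C_n_ext (a b : R) (n : nat) (f g : R -> R) :
  (forall r, a < r < b -> f r = g r) -> C_n a b n f -> C_n a b n g.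
Proof.
  destruct n as [|n]; [easy|].
  intros hfg [f' [h1 h2]]; exists f'; split; [|exact h2].
  intros r hr; apply is_derive_ext_loc with f; [|auto].
  apply filter_imp with (2 := locally_interval a b r hr); auto.
Qed.

Lemma C_n_const (a b c : R) (n : nat) : C_n a b n (fun _ => c).
Proof.
  revert c; induction n as [|n IH]; intros c; [easy|].
  exists (fun _ => 0); split; [|apply IH].
  intros r _; apply @is_derive_const.
Qed.

Lemma C_n_id (a b : R) (n : nat) : C_n a b n (fun r => r).
Proof.
  destruct n as [|n]; [easy|].
  exists (fun _ => 1); split; [|apply C_n_const].
  intros r _; apply @is_derive_id.
Qed.

Lemma C_n_plus (a b : R) (n : nat) (f g : R -> R) :
  C_n a b n f -> C_n a b n g -> C_n a b n (fun r => f r + g r).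
Proof.
  revert f g; induction n as [|n IH]; intros f g; [easy|].
  intros [f' [hf hf']] [g' [hg hg']]; exists (fun r => f' r + g' r).
  split; [|apply IH; auto].
  intros r hr; apply @is_derive_plus; auto.
Qed.

Lemma C_n_mult (a b : R) (n : nat) (f g : R -> R) :
  C_n a b n f -> C_n a b n g -> C_n a b n (fun r => f r * g r).
Proof.
  revert f g; induction n as [|n IH]; intros f g; [easy|].
  intros hf hg; assert (hfn := C_n_pred _ _ _ _ hf).
  assert (hgn := C_n_pred _ _ _ _ hg).
  destruct hf as [f' [hf hf']], hg as [g' [hg hg']].
  exists (fun r => f' r * g r + f r * g' r); split.
  - intros r hr; apply (is_derive_mult f g); auto; intros; apply Rmult_comm.
  - apply C_n_plus; apply IH; auto.
Qed.

Lemma C_n_inv (a b : R) (n : nat) (f : R -> R) :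
  (forall r, a < r < b -> f r <> 0) -> C_n a b n f -> C_n a b n (fun r => / f r).
Proof.
  intros hf0; induction n as [|n IH]; [easy|].
  intros hf; specialize (IH (C_n_pred _ _ _ _ hf)).
  destruct hf as [f' [hf hf']].
  (* A product of known factors, so that [C_n_mult] applies with the induction hypothesis for
     [/ f]. *)
  exists (fun r => (-1 * f' r) * (/ f r * / f r)); split.
  - intros r hr; specialize (hf0 r hr).
    replace (-1 * f' r * (/ f r * / f r)) with (- f' r / f r ^ 2) by (field; auto).
    apply is_derive_inv; auto.
  - repeat apply C_n_mult; auto using C_n_const.
Qed.

Lemma C_n_exp (a b : R) (n : nat) (f : R -> R) :
  C_n a b n f -> C_n a b n (fun r => exp (f r)).
Proof.
  induction n as [|n IH]; [easy|].
  intros hf; specialize (IH (C_n_pred _ _ _ _ hf)).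
  destruct hf as [f' [hf hf']].
  exists (fun r => f' r * exp (f r)); split.
  - intros r hr; apply (is_derive_comp exp f); auto; apply is_derive_exp.
  - apply C_n_mult; auto.
Qed.

(** [C_n] peels off the innermost derivative and [Derive_n] the outermost; [Derive_n_comp] exchanges
    the two. Order 0 is trivial, so the induction starts at order 1. *)
Lemma C_n_ex_derive_n (a b : R) (n : nat) (f : R -> R) :
  C_n a b n f -> forall r, a < r < b -> ex_derive_n f n r.
Proof.
  destruct n as [|n]; [easy|].
  revert f; induction n as [|n IH]; intros f [f' [hf hf']] r hr.
  - exists (f' r); auto.
  - specialize (IH f' hf' r hr); simpl in IH |- *.
    apply ex_derive_ext_loc with (2 := IH).
    apply filter_imp with (2 := locally_interval a b r hr); intros s hs.
    change (Derive_n f' n s = Derive_n f (S n) s).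
    replace (S n) with (n + 1)%nat by ring.
    rewrite <- (Derive_n_comp f n 1).
    apply Derive_n_ext_loc.
    apply filter_imp with (2 := locally_interval a b s hs); intros t ht.
    symmetry; apply is_derive_unique; auto.
Qed.

Lemma C_n_C1_in (a b : R) (f : R -> R) : C_n a b 2 f -> C1_in a b f.
Proof.
  intros [f' [hf [f'' [hf' _]]]] r hr; split; [exists (f' r); auto|].
  apply continuous_ext_loc with f'.
  - apply filter_imp with (2 := locally_interval a b r hr); intros s hs.
    symmetry; apply is_derive_unique; auto.
  - apply @ex_derive_continuous; exists (f'' r); auto.
Qed.

(* The derivative of the branch is a smooth function of the branch itself, so
   each order of differentiability yields the next. *)
Lemma C_n_inverse_branch_head (e c b a0 a1 : R) (h : R -> R) (n : nat) :
  e * e = 1 -> inverse_branch e h -> 0 <= a0 ->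
  (forall r, a0 < r < a1 -> 1 < head c b r) ->
  C_n a0 a1 n (fun r => h (head c b r)).
Proof.
  intros he hh ha0 h1; induction n as [|n IH]; [easy|].
  exists (fun r => (2 * / r + 2 * b * (/ r * (/ r * / r)))
                   * / (e * (exp (e * h (head c b r)) + -1))); split.
  - intros r hr.
    destruct (inverse_branch_derive e _ h he hh (h1 r hr)) as [_ [hd hder]].
    replace (2 * / r + 2 * b * (/ r * (/ r * / r))) with (2 / r + 2 * b / r ^ 3)
      by (field; lra).
    apply (is_derive_comp h (head c b)); [exact hder|].
    apply head_derive; lra.
  - assert (hr : C_n a0 a1 n (fun r => / r)).
    { apply C_n_inv; [intros; lra | apply C_n_id]. }
    apply C_n_mult.
    + apply C_n_plus; repeat apply C_n_mult; auto using C_n_const.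
    + apply (C_n_inv _ _ _ (fun r => e * (exp (e * h (head c b r)) + -1))).
      * intros r hr'.
        destruct (inverse_branch_derive e _ h he hh (h1 r hr')) as [_ [hd _]]. lra.
      * apply C_n_mult; [apply C_n_const|].
        apply C_n_plus; [|apply C_n_const].
        apply C_n_exp, C_n_mult; auto using C_n_const.
Qed.

(** * First integrals *)

Lemma left_continuous_mult (f g : R -> R) (r : R) :
  left_continuous f r -> left_continuous g r ->
  left_continuous (fun s => f s * g s) r.
Proof.
  intros hf hg.
  exact (filterlim_comp_2 f g Rmult hf hg (filterlim_mult (K := R_AbsRing) (f r) (g r))).
Qed.

Lemma left_continuous_plus (f g : R -> R) (r : R) :
  left_continuous f r -> left_continuous g r ->
  left_continuous (fun s => f s + g s) r.
Proof.
  intros hf hg.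
  exact (filterlim_comp_2 f g Rplus hf hg
           (filterlim_plus (V := R_NormedModule) (f r) (g r))).
Qed.

Lemma left_continuous_comp (f g : R -> R) (r : R) :
  left_continuous f r -> continuous g (f r) -> left_continuous (fun s => g (f s)) r.
Proof. intros hf hg; exact (filterlim_comp _ _ _ f g _ _ _ hf hg). Qed.

Lemma continuous_left (f : R -> R) (r : R) : continuous f r -> left_continuous f r.
Proof. intros hf; apply (filterlim_filter_le_1 f (filter_le_within _) hf). Qed.

Lemma continuous_right (f : R -> R) (r : R) : continuous f r -> right_continuous f r.
Proof. intros hf; apply (filterlim_filter_le_1 f (filter_le_within _) hf). Qed.

Lemma at_left_interval (a b : R) : a < b -> at_left b (fun s => a < s < b).
Proof.
  intros hab; unfold at_left, within.
  apply filter_imp with (fun s => a < s); [intros; split; auto|].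
  apply open_gt; exact hab.
Qed.

(** The left limit at [b] is both the constant interior value and [f b]. This carries the first
    integrals to the outer circle, where only left continuity is known. *)
Lemma constant_upto_right_end (f : R -> R) (a b r : R) :
  (forall s, a < s < b -> is_derive f s 0) -> left_continuous f b ->
  a < r <= b -> f r = f b.
Proof.
  intros hd hl hr; destruct (Req_dec r b) as [->|hne]; [reflexivity|].
  assert (hrb : r < b) by lra.
  apply (filterlim_locally_unique (V := R_NormedModule) (F := at_left b) f); [|exact hl].
  apply filterlim_ext_loc with (fun _ => f r); [|apply filterlim_const].
  generalize (at_left_interval r b hrb); apply filter_imp; intros s hs.
  apply (eq_is_derive f); [|lra].
  intros t ht; apply hd; lra.
Qed.

Definition bernoulli (A d u v : R) : R := / 2 * (u ^ 2 + v ^ 2) + A * ln d.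

Lemma first_integrals (A r1 rho0 U10 U20 r0 : R) (v : flow) :
  0 < A -> 0 < r1 -> 0 < rho0 -> U10 < 0 -> 0 <= r0 ->
  C1_solution A r1 rho0 U10 U20 r0 v ->
  forall r, r0 < r <= r1 ->
    0 < rho v r /\ r * rho v r * U1 v r = m1 r1 rho0 U10 /\
    r * U2 v r = m2 r1 U20 /\
    bernoulli A (rho v r) (U1 v r) (U2 v r) = B0 A rho0 U10 U20.
Proof.
  intros hA hr1 hrho0 hU hr0 [[hC1 [hC2 hC3]] [[hl1 [hl2 hl3]] [hpos [heq [e1 [e2 e3]]]]]].
  destruct v as [d u w]; unfold euler_equations in heq; cbn [rho U1 U2] in *.
  assert (hid : left_continuous (fun r => r) r1) by (apply continuous_left, continuous_id).
  assert (hdd : forall r, r0 < r < r1 ->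
    is_derive d r (Derive d r) /\ is_derive u r (Derive u r) /\ is_derive w r (Derive w r)).
  { intros r hr; refine (conj _ (conj _ _)); apply Derive_correct;
      [apply (hC1 r hr) | apply (hC2 r hr) | apply (hC3 r hr)]. }
  assert (hm1 : forall r, r0 < r <= r1 -> r * d r * u r = r1 * d r1 * u r1).
  { intros r hr; apply (constant_upto_right_end (fun r => r * d r * u r) r0); auto.
    - intros s hs; destruct (hdd s hs) as [h1 [h2 h3]].
      destruct (heq s hs) as [q _].
      rewrite Derive_mult in q by (eexists; eauto).
      replace 0 with ((1 * d s + s * Derive d s) * u s + s * d s * Derive u s).
      + apply (is_derive_mult (fun s => s * d s) u); [| exact h2 | intros; apply Rmult_comm].
        apply (is_derive_mult (fun s => s) d); [apply @is_derive_id | exact h1 |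
          intros; apply Rmult_comm].
      + transitivity (s * (Derive d s * u s + d s * Derive u s + / s * (d s * u s))).
        * field; lra.
        * rewrite q; ring.
    - repeat apply left_continuous_mult; auto. }
  (* The mass flux is nonzero, so the radial velocity never vanishes and the angular equation can be
     divided by it. *)
  assert (hneg : forall r, r0 < r < r1 -> u r <> 0).
  { intros r hr h0; assert (h := hm1 r ltac:(lra)); rewrite h0, e1, e2 in h.
    assert (0 < r1 * rho0) by nra. nra. }
  assert (hm2 : forall r, r0 < r <= r1 -> r * w r = r1 * w r1).
  { intros r hr; apply (constant_upto_right_end (fun r => r * w r) r0); auto.
    - intros s hs; destruct (hdd s hs) as [h1 [h2 h3]].
      destruct (heq s hs) as [_ [_ q]].
      replace 0 with (1 * w s + s * Derive w s).
      + apply (is_derive_mult (fun s => s) w); [apply @is_derive_id | exact h3 |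
          intros; apply Rmult_comm].
      + apply Rmult_eq_reg_l with (u s); auto.
        transitivity (s * (u s * Derive w s + u s * w s / s)).
        * field; lra.
        * rewrite q; ring.
    - apply left_continuous_mult; auto. }
  assert (hB : forall r, r0 < r <= r1 ->
    bernoulli A (d r) (u r) (w r) = bernoulli A (d r1) (u r1) (w r1)).
  { intros r hr; unfold bernoulli.
    apply (constant_upto_right_end
             (fun r => / 2 * (u r ^ 2 + w r ^ 2) + A * ln (d r)) r0); auto.
    - intros s hs; destruct (hdd s hs) as [h1 [h2 h3]].
      destruct (heq s hs) as [_ [q2 q3]].
      assert (hds := hpos s hs).
      evar_last.
      + auto_derive; [repeat (split; [eexists; eassumption|]); auto | reflexivity].
      + change (fun x => d x) with d; change (fun x => u x) with u;
          change (fun x => w x) with w.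
        (* After this substitution, [d s] times the derivative of the Bernoulli function is the left
           side of the radial momentum equation. *)
        assert (q3' : Derive w s = - w s / s).
        { apply Rmult_eq_reg_l with (u s); auto.
          transitivity ((u s * Derive w s + u s * w s / s) - u s * w s / s);
            [ring | rewrite q3; field; lra]. }
        rewrite q3'; apply Rmult_eq_reg_l with (d s); [|lra].
        transitivity (d s * u s * Derive u s - d s * w s ^ 2 / s + A * Derive d s);
          [field; lra | rewrite q2; ring].
    - apply left_continuous_plus; apply left_continuous_mult.
      + apply continuous_left, continuous_const.
      + apply left_continuous_plus; repeat apply left_continuous_mult; auto;
          apply continuous_left, continuous_const.
      + apply continuous_left, continuous_const.
      + apply (left_continuous_comp d ln); auto; apply continuous_ln; lra. }
  intros r hr; split; [|split; [|split]].
  - destruct (Req_dec r r1) as [->|]; [lra | apply hpos; lra].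
  - rewrite hm1, e1, e2; auto.
  - rewrite hm2, e3; auto.
  - rewrite hB, e1, e2, e3; auto.
Qed.

(** * Reduction to the radial Mach number *)

Lemma mach2_pos (A U : R) : 0 < A -> U < 0 -> 0 < mach2 A U.
Proof. intros; unfold mach2; apply Rdiv_lt_0_compat; nra. Qed.

Lemma Phi_ln_mach2 (A r d u w m m' B : R) :
  0 < A -> 0 < r -> 0 < d -> m < 0 -> r * d * u = m -> r * w = m' ->
  bernoulli A d u w = B ->
  Phi (ln (mach2 A u)) = head (2 * B / A + ln (A / m ^ 2)) (m' ^ 2 / A) r.
Proof.
  intros hA hr hd hm <- <- <-.
  assert (hrd : 0 < r * d) by nra.
  assert (hu : u < 0) by nra.
  unfold Phi, head, bernoulli.
  rewrite exp_ln by (apply mach2_pos; auto).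
  assert (hs : 0 < A / (r * d * u) ^ 2) by (apply Rdiv_lt_0_compat; nra).
  assert (hl : ln (mach2 A u) + ln (A / (r * d * u) ^ 2) + 2 * ln r + 2 * ln d = 0).
  { assert (hmu := mach2_pos A u hA hu).
    assert (hp : mach2 A u * (A / (r * d * u) ^ 2) * (r * r) * (d * d) = 1)
      by (unfold mach2; field; repeat split; lra).
    apply (f_equal ln) in hp; rewrite ln_1 in hp.
    rewrite !ln_mult in hp by (repeat (assumption || apply Rmult_lt_0_compat)).
    lra. }
  assert (hl' : ln (mach2 A u) = - (ln (A / (r * d * u) ^ 2) + 2 * ln r + 2 * ln d)) by lra.
  rewrite hl'; unfold mach2; field; lra.
Qed.

(** The Mach number fixes the velocity up to sign; inflow selects the negative root. *)
Lemma velocity_of_mach2 (A u : R) :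
  0 < A -> u < 0 -> u = - sqrt A * exp (ln (mach2 A u) / 2).
Proof.
  intros hA hu.
  assert (hs := sqrt_lt_R0 A hA).
  assert (hq : 0 < - u / sqrt A) by (apply Rdiv_lt_0_compat; lra).
  replace (mach2 A u) with ((- u / sqrt A) * (- u / sqrt A)).
  - rewrite ln_mult by auto.
    replace ((ln (- u / sqrt A) + ln (- u / sqrt A)) / 2) with (ln (- u / sqrt A)) by field.
    rewrite exp_ln by auto; field; lra.
  - unfold mach2; rewrite <- (sqrt_sqrt A) at 3 by lra; field; lra.
Qed.

Lemma mach2_exp (A x : R) : 0 < A -> mach2 A (- sqrt A * exp (x / 2)) = exp x.
Proof.
  intros hA; unfold mach2.
  replace (exp x) with (exp (x / 2) * exp (x / 2)) by (rewrite <- exp_plus; f_equal; field).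
  rewrite <- (sqrt_sqrt A) at 2 by lra; field.
  assert (hs := sqrt_lt_R0 A hA); lra.
Qed.

(** * The flow on a branch *)

(** With [t = e * h (head c b r)], the squared radial Mach number is [exp t] and the density is the
    mass flux [m] divided by [r * U1]. *)
Definition branch_flow (A m m' c b e : R) (h : R -> R) : flow :=
  mkFlow (fun r => - m / (r * sqrt A) * exp (- (e * h (head c b r) / 2)))
         (fun r => - sqrt A * exp (e * h (head c b r) / 2))
         (fun r => m' / r).

(** Serves twice: at [r1] it shows that the branch flow takes the incoming data, and at other radii
    it identifies any solution with the branch flow. *)
Lemma branch_flow_determined (A r d u w m m' c b e : R) (h : R -> R) :
  0 < A -> 0 < r -> 0 < d -> u < 0 -> r * d * u = m -> r * w = m' ->
  e * h (head c b r) = ln (mach2 A u) ->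
  d = rho (branch_flow A m m' c b e h) r /\
  u = U1 (branch_flow A m m' c b e h) r /\
  w = U2 (branch_flow A m m' c b e h) r.
Proof.
  intros hA hr hd hu <- <- he; simpl; rewrite he.
  assert (hv := velocity_of_mach2 A u hA hu).
  assert (hp := exp_pos (ln (mach2 A u) / 2)).
  assert (hs := sqrt_lt_R0 A hA).
  split; [|split; [exact hv | field; lra]].
  rewrite exp_Ropp, hv at 1; field; lra.
Qed.

(** Since [head] increases strictly, [1 <= head c b r0] gives strict inequality inside the annulus,
    hence smoothness there. At [r0] itself equality may hold and only continuity is obtained. *)
Lemma branch_flow_smooth (A m m' c b e r0 r1 : R) (h : R -> R) :
  0 < A -> m < 0 -> b = m' ^ 2 / A -> e * e = 1 -> inverse_branch e h ->
  0 < r0 < r1 -> 1 <= head c b r0 ->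
  let u := branch_flow A m m' c b e h in
  smooth_solution A r1 (rho u r1) (U1 u r1) (U2 u r1) r0 u.
Proof.
  intros hA hm hb he hh hr h1 u.
  assert (hs := sqrt_lt_R0 A hA).
  assert (hs2 := sqrt_sqrt A (Rlt_le _ _ hA)).
  assert (hb0 : 0 <= b) by (rewrite hb; apply Rdiv_le_0_compat; nra).
  assert (hh1 : forall r, r0 < r < r1 -> 1 < head c b r).
  { intros r hr'; assert (head c b r0 < head c b r) by (apply head_increasing; lra); lra. }
  assert (hT : forall n, C_n r0 r1 n (fun r => h (head c b r))).
  { intros n; apply (C_n_inverse_branch_head e); auto; lra. }
  assert (hcT : forall r, 0 < r -> continuous (fun r => h (head c b r)) r).
  { intros r hr'; apply (continuous_comp (head c b) h).
    - apply @ex_derive_continuous; eexists; apply head_derive; auto.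
    - apply (inverse_branch_continuous e); auto. }
  (* Used with [s = - e / 2] for the density and [s = e / 2] for the radial velocity. *)
  assert (hE : forall s, (forall n, C_n r0 r1 n (fun r => exp (s * h (head c b r)))) /\
                forall r, 0 < r -> continuous (fun r => exp (s * h (head c b r))) r).
  { intros s; split.
    - intros n; apply C_n_exp, C_n_mult; auto using C_n_const.
    - intros r hr'; apply (continuous_comp _ exp); [|apply continuous_exp].
      apply (continuous_mult (fun _ => s)); [apply continuous_const | auto]. }
  assert (hI : (forall n, C_n r0 r1 n (fun r => / r)) /\
                forall r, 0 < r -> continuous (fun r => / r) r).
  { split.
    - intros n; apply C_n_inv; [intros; lra | apply C_n_id].
    - intros r hr'; apply continuous_Rinv_comp; [apply continuous_id | lra]. }
  assert (hrho : (forall n, C_n r0 r1 n (rho u)) /\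
                  forall r, 0 < r -> continuous (rho u) r).
  { assert (hx : forall r, 0 < r ->
      (- m / sqrt A * / r) * exp (- e / 2 * h (head c b r)) = rho u r).
    { intros r hr'; simpl; f_equal; [field; lra | f_equal; field]. }
    split.
    - intros n; eapply C_n_ext; [intros s hs0; apply hx; lra|].
      repeat apply C_n_mult; auto using C_n_const; [apply hI | apply hE].
    - intros r hr'; eapply continuous_ext_loc.
      + apply filter_imp with (fun r => 0 < r); [exact hx | apply (open_gt 0); auto].
      + apply (continuous_mult (fun r => - m / sqrt A * / r)); [|apply hE; auto].
        apply (continuous_mult (fun _ => - m / sqrt A)); [apply continuous_const|].
        apply hI; auto. }
  assert (hU1 : (forall n, C_n r0 r1 n (U1 u)) /\
                  forall r, 0 < r -> continuous (U1 u) r).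
  { assert (hx : forall r, - sqrt A * exp (e / 2 * h (head c b r)) = U1 u r).
    { intros r; simpl; f_equal; f_equal; field. }
    split.
    - intros n; apply (C_n_ext _ _ _ _ _ (fun r _ => hx r)).
      apply C_n_mult; [apply C_n_const | apply hE].
    - intros r hr'; apply (continuous_ext _ _ _ hx).
      apply (continuous_mult (fun _ => - sqrt A)); [apply continuous_const|].
      apply hE; auto. }
  assert (hU2 : (forall n, C_n r0 r1 n (U2 u)) /\
                  forall r, 0 < r -> continuous (U2 u) r).
  { split.
    - intros n; apply C_n_mult; [apply C_n_const | apply hI].
    - intros r hr'; apply (continuous_mult (fun _ => m')); [apply continuous_const|].
      apply hI; auto. }
  destruct hrho as [hrho hrhoc], hU1 as [hU1 hU1c], hU2 as [hU2 hU2c].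
  split; [|split].
  - split; [|split; [|split; [|split]]].
    + refine (conj _ (conj _ _)); apply C_n_C1_in; auto.
    + refine (conj _ (conj _ _)); apply continuous_left; [apply hrhoc | apply hU1c | apply hU2c]; lra.
    + intros r hr'; simpl; apply Rmult_lt_0_compat; [|apply exp_pos].
      apply Rdiv_lt_0_compat; [lra | apply Rmult_lt_0_compat; lra].
    + intros r hr'.
      destruct (inverse_branch_derive e _ h he hh (hh1 r hr')) as [_ [hd hder]].
      set (T' := (2 / r + 2 * b / r ^ 3) * / (e * (exp (e * h (head c b r)) - 1))).
      set (T := fun r => h (head c b r)).
      assert (hT' : is_derive T r T').
      { apply (is_derive_comp h (head c b)); [exact hder|]. apply head_derive; lra. }
      assert (hU1' : is_derive (U1 u) r (U1 u r * (e * T' / 2))).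
      { change (is_derive (fun r => - sqrt A * exp (e * T r / 2)) r
                  (- sqrt A * exp (e * T r / 2) * (e * T' / 2))).
        clearbody T; evar_last.
        - auto_derive; [exists T'; exact hT' | reflexivity].
        - change (fun x => T x) with T.
          rewrite (is_derive_unique _ _ _ hT'); unfold Rdiv; ring. }
      assert (hrho' : is_derive (rho u) r (rho u r * (- / r - e * T' / 2))).
      { change (is_derive (fun r => - m / (r * sqrt A) * exp (- (e * T r / 2))) r
                  (- m / (r * sqrt A) * exp (- (e * T r / 2)) * (- / r - e * T' / 2))).
        clearbody T; evar_last.
        - auto_derive; [|reflexivity].
          split; [apply Rmult_integral_contrapositive_currified; lra|].
          split; [exists T'; exact hT' | exact I].
        - change (fun x => T x) with T.
          rewrite (is_derive_unique _ _ _ hT'); unfold Rdiv; field; lra. }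
      assert (hU2' : is_derive (U2 u) r (- m' / r ^ 2)).
      { simpl; auto_derive; [lra | simpl; field; lra]. }
      assert (hm2 : mach2 A (U1 u r) = exp (e * h (head c b r))) by (apply mach2_exp; auto).
      assert (hU1A : U1 u r ^ 2 = A * exp (e * h (head c b r))).
      { rewrite <- hm2; unfold mach2; field; lra. }
      rewrite (is_derive_unique _ _ _ hU1'), (is_derive_unique _ _ _ hU2'),
        (is_derive_unique _ _ _ hrho').
      split; [|split].
      * rewrite Derive_mult by (eexists; eauto).
        change (fun s => rho u s) with (rho u); change (fun s => U1 u s) with (U1 u).
        rewrite (is_derive_unique _ _ _ hU1'), (is_derive_unique _ _ _ hrho').
        field; lra.
      (* With [U1 ^ 2 = A * exp (e * T)] and [U2 ^ 2 = A * b / r ^ 2], the momentum equation becomes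
         [e * (exp (e * T) - 1) * T' = 2 / r + 2 * b / r ^ 3], the derivative of
         [Phi (e * T) = head c b r]. *)
      * transitivity (rho u r * (U1 u r ^ 2 * (e * T' / 2) - U2 u r ^ 2 / r
                        + A * (- / r - e * T' / 2))); [field; lra|].
        rewrite hU1A; unfold T'.
        change (U2 u r) with (m' / r).
        replace (m' / r) with (m' * / r) by reflexivity.
        assert (hmb : m' ^ 2 = A * b) by (rewrite hb; field; lra).
        replace ((m' * / r) ^ 2) with (A * b * / r ^ 2) by (rewrite <- hmb; field; lra).
        assert (he0 : e <> 0) by (intros ->; lra).
        assert (hx0 : exp (e * h (head c b r)) - 1 <> 0) by (intros hx0; rewrite hx0 in hd; lra).
        field; repeat split; auto; lra.
      * change (U2 u r) with (m' / r); field; lra.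
    + auto.
  - refine (conj _ (conj _ _)); intros n r hr'; apply (C_n_ex_derive_n r0 r1); auto.
  - refine (conj _ (conj _ _)); apply continuous_right; [apply hrhoc | apply hU1c | apply hU2c]; lra.
Qed.

(** * Existence, uniqueness and nonexistence of solutions *)

Lemma solution_on_branch (A r1 rho0 U10 U20 r0 c b e : R) (h : R -> R) (v : flow) :
  0 < A -> 0 < r1 -> 0 < rho0 -> U10 < 0 -> 0 <= r0 ->
  c = 2 * B0 A rho0 U10 U20 / A + ln (A / m1 r1 rho0 U10 ^ 2) ->
  b = m2 r1 U20 ^ 2 / A ->
  e * e = 1 -> inverse_branch e h -> 0 < e * ln (mach2 A U10) ->
  C1_solution A r1 rho0 U10 U20 r0 v ->
  (forall r, r0 < r <= r1 -> 1 < head c b r) ->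
  forall r, r0 < r <= r1 -> e * h (head c b r) = ln (mach2 A (U1 v r)).
Proof.
  intros hA hr1 hrho0 hU hr0 hc hb he hh hsign hv hgt.
  assert (hfi := first_integrals A r1 rho0 U10 U20 r0 v hA hr1 hrho0 hU hr0 hv).
  assert (hm : m1 r1 rho0 U10 < 0).
  { unfold m1; assert (0 < r1 * rho0) by (apply Rmult_lt_0_compat; lra); nra. }
  set (t := fun r => ln (mach2 A (U1 v r))).
  assert (ht : forall r, r0 < r <= r1 -> Phi (t r) = head c b r).
  { intros r hr; destruct (hfi r hr) as [h1 [h2 [h3 h4]]]; unfold t; rewrite hc, hb.
    apply (Phi_ln_mach2 A r (rho v r) (U1 v r) (U2 v r)); auto; lra. }
  assert (hneg : forall r, r0 < r <= r1 -> U1 v r < 0).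
  { intros r hr; destruct (hfi r hr) as [h1 [h2 _]].
    assert (0 < r * rho v r) by (apply Rmult_lt_0_compat; lra). nra. }
  assert (hg : forall r, U1 v r < 0 -> continuous (fun y => e * ln (mach2 A y)) (U1 v r)).
  { intros r hr; apply (ex_derive_continuous (fun y => e * ln (mach2 A y))).
    assert (hp := mach2_pos A (U1 v r) hA hr); revert hp; unfold mach2; intros hp.
    auto_derive; exact hp. }
  destruct hv as [[_ [hC1 _]] [[_ [hl _]] [_ [_ [_ [hb1 _]]]]]].
  (* Where the branches meet [head] equals 1, so a solution cannot cross. *)
  assert (hpos : forall r, r0 < r <= r1 -> 0 < e * t r).
  { intros r hr.
    assert (ht1 : e * t r1 > 0) by (unfold t; rewrite hb1; exact hsign).
    destruct (Req_dec r r1) as [->|hne]; [exact ht1|].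
    assert (hrr : r < r1) by lra.
    assert (hlt : left_continuous (fun s => e * t s) r1).
    { apply (left_continuous_comp (U1 v) (fun y => e * ln (mach2 A y))); auto.
      apply hg, hneg; lra. }
    (* The intermediate value theorem needs two-sided continuity at its end points, so [r1] is
       replaced by a nearby interior point [s] with the same sign. *)
    assert (hev : at_left r1 (fun s => 0 < e * t s))
      by (apply hlt; apply (open_gt 0); exact ht1).
    destruct (filter_ex (F := at_left r1) _
                (filter_and _ _ hev (at_left_interval r r1 hrr))) as [s [hs1 hs2]].
    destruct (Rlt_or_le 0 (e * t r)) as [l | [l | l]]; auto; exfalso.
    - assert (hct : forall x, r <= x <= s -> continuity_pt (fun x => e * t x) x).
      { intros x hx; apply continuity_pt_filterlim.
        apply (continuous_comp (U1 v) (fun y => e * ln (mach2 A y))).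
        - apply (ex_derive_continuous (U1 v) x), (hC1 x); lra.
        - apply hg, hneg; lra. }
      destruct (Ranalysis5.IVT_interv _ r s hct (proj1 hs2) l hs1) as [z [hz hz0]].
      assert (tz : t z = 0) by (apply Rmult_integral in hz0; destruct hz0; [nra|auto]).
      assert (hhz := hgt z ltac:(lra)).
      rewrite <- ht, tz, Phi_0 in hhz; lra.
    - assert (tz : t r = 0) by (apply Rmult_integral in l; destruct l; [nra|auto]).
      assert (hhz := hgt r ltac:(lra)).
      rewrite <- ht, tz, Phi_0 in hhz; lra. }
  intros r hr; change (e * h (head c b r) = t r).
  assert (hte : t r = e * (e * t r)) by (rewrite <- Rmult_assoc, he; ring).
  rewrite <- ht, hte at 1 by auto.
  rewrite (inverse_branch_unique e _ h he hh) by (left; auto).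
  symmetry; exact hte.
Qed.

(** The type [P] is left arbitrary: each case of the classification then only has to be checked on
    the branch flow. *)
Lemma global_solution (A r1 rho0 U10 U20 c b : R) :
  0 < A -> 0 < r1 -> 0 < rho0 -> U10 < 0 -> mach2 A U10 <> 1 ->
  c = 2 * B0 A rho0 U10 U20 / A + ln (A / m1 r1 rho0 U10 ^ 2) ->
  b = m2 r1 U20 ^ 2 / A ->
  exists (e : R) (h : R -> R) (rsharp : R),
    e * e = 1 /\ 0 < e * ln (mach2 A U10) /\ inverse_branch e h /\
    0 < rsharp < r1 /\ head c b rsharp = 1 /\
    e * h (head c b r1) = ln (mach2 A U10) /\
    (forall r0, 0 < r0 < rsharp -> ~ exists u, C1_solution A r1 rho0 U10 U20 r0 u) /\
    forall r0, 0 < r0 < r1 -> rsharp <= r0 -> forall P : flow -> Prop,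
      P (branch_flow A (m1 r1 rho0 U10) (m2 r1 U20) c b e h) ->
      exists_unique_smooth A r1 rho0 U10 U20 r0 P.
Proof.
  intros hA hr1 hrho0 hU hM hc hb.
  assert (hmp := mach2_pos A U10 hA hU).
  assert (hb0 : 0 <= b) by (rewrite hb; apply Rdiv_le_0_compat; [nra | lra]).
  assert (hm : m1 r1 rho0 U10 < 0).
  { unfold m1; assert (0 < r1 * rho0) by (apply Rmult_lt_0_compat; lra); nra. }
  assert (ht0 : ln (mach2 A U10) <> 0).
  { intros h0; apply hM; rewrite <- (exp_ln (mach2 A U10)), h0, exp_0; auto. }
  assert (hphi : Phi (ln (mach2 A U10)) = head c b r1).
  { rewrite hc, hb; apply (Phi_ln_mach2 A r1 rho0 U10 U20); auto. }
  assert (h1 : 1 < head c b r1).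
  (* Strict because the incoming radial Mach number is not 1; hence the limiting circle lies
     strictly inside [r1]. *)
  { rewrite <- hphi; unfold Phi; generalize (exp_ineq1 _ ht0); lra. }
  assert (exists e, e * e = 1 /\ 0 < e * ln (mach2 A U10)) as [e [he hsign]].
  { destruct (Rdichotomy _ _ ht0); [exists (-1) | exists 1]; lra. }
  destruct (inverse_branch_exists e he) as [h hh].
  destruct (head_level c b r1 hb0 hr1 h1) as [rsharp [hrs hrs1]].
  assert (hend : e * h (head c b r1) = ln (mach2 A U10)).
  { rewrite <- hphi.
    assert (hte : ln (mach2 A U10) = e * (e * ln (mach2 A U10)))
      by (rewrite <- Rmult_assoc, he; ring).
    rewrite hte at 1; rewrite (inverse_branch_unique e _ h he hh) by lra.
    symmetry; exact hte. }
  exists e, h, rsharp; repeat (split; [assumption|]); split.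
  - intros r0 hr0 [v hv].
    (* A radius in the domain of the solution but inside the limiting circle, where [head] is below
       the minimum of [Phi]. *)
    set (r := (r0 + rsharp) / 2).
    destruct (first_integrals A r1 rho0 U10 U20 r0 v hA hr1 hrho0 hU ltac:(lra) hv r
                ltac:(unfold r; lra)) as [q1 [q2 [q3 q4]]].
    assert (hr : 0 < r < rsharp) by (unfold r; lra).
    assert (hP := Phi_ln_mach2 A r _ _ _ _ _ _ hA (proj1 hr) q1 hm q2 q3 q4).
    rewrite <- hc, <- hb in hP.
    assert (head c b r < head c b rsharp) by (apply head_increasing; lra).
    generalize (Phi_ge1 (ln (mach2 A (U1 v r)))); lra.
  - intros r0 hr0 hsr P hP.
    exists (branch_flow A (m1 r1 rho0 U10) (m2 r1 U20) c b e h).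
    assert (hincr : forall r, rsharp < r -> 1 < head c b r).
    { intros r hr; rewrite <- hrs1; apply head_increasing; lra. }
    assert (hge : 1 <= head c b r0).
    { destruct (Req_dec r0 rsharp) as [->|]; [lra | left; apply hincr; lra]. }
    split; [|split; [exact hP|]].
    + destruct (branch_flow_determined A r1 rho0 U10 U20 (m1 r1 rho0 U10) (m2 r1 U20)
                  c b e h) as [q1 [q2 q3]]; auto.
      assert (hsm := branch_flow_smooth A (m1 r1 rho0 U10) (m2 r1 U20) c b e r0 r1 h
                       hA hm hb he hh hr0 hge).
      cbv zeta in hsm; rewrite <- q1, <- q2, <- q3 in hsm; exact hsm.
    + intros v hv r hr.
      destruct (first_integrals A r1 rho0 U10 U20 r0 v hA hr1 hrho0 hU ltac:(lra) hv r hr)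
        as [q1 [q2 [q3 q4]]].
      apply branch_flow_determined; auto; try lra.
      * assert (0 < r * rho v r) by (apply Rmult_lt_0_compat; lra). nra.
      * apply (solution_on_branch A r1 rho0 U10 U20 r0 c b e h v); auto; try lra.
        intros s hs; apply hincr; lra.
Qed.

(** * The total Mach number and the sonic circle *)

Lemma total_mach2_branch_flow (A m m' c b e r : R) (h : R -> R) :
  0 < A -> 0 < r -> b = m' ^ 2 / A ->
  total_mach2 A (branch_flow A m m' c b e h) r = exp (e * h (head c b r)) + b / r ^ 2.
Proof.
  intros hA hr ->; unfold total_mach2; cbn [U1 U2 branch_flow].
  rewrite mach2_exp by auto; f_equal; unfold mach2; field; lra.
Qed.

(** The exponential term decreases strictly because [h] and [head] increase, and [b / r ^ 2] does
    not increase. The bound [1 <= head c b r] keeps away from the levels where [h] is constantly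
    0. *)
Lemma total_mach2_decreasing (A m m' c b r s : R) (h : R -> R) :
  0 < A -> b = m' ^ 2 / A -> inverse_branch (-1) h ->
  0 < r < s -> 1 <= head c b r ->
  let u := branch_flow A m m' c b (-1) h in
  total_mach2 A u s < total_mach2 A u r.
Proof.
  intros hA hb hh hrs h1 u; unfold u.
  assert (hb0 : 0 <= b) by (rewrite hb; apply Rdiv_le_0_compat; nra).
  rewrite !total_mach2_branch_flow by (auto; lra).
  assert (hi : head c b r < head c b s) by (apply head_increasing; auto).
  assert (hlt : h (head c b r) < h (head c b s)).
  { destruct (hh (head c b r)) as [g1 g2].
    apply (inverse_branch_gt (-1)); auto; [ring|].
    rewrite g2, Rmax_right; lra. }
  assert (exp (-1 * h (head c b s)) < exp (-1 * h (head c b r)))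
    by (apply exp_increasing; lra).
  assert (b / s ^ 2 <= b / r ^ 2) by (apply inv_sqr_le; lra).
  lra.
Qed.

Lemma sonic_radius (A r1 rho0 U10 U20 c b : R) (h : R -> R) :
  0 < A -> 0 < r1 -> 0 < rho0 -> U10 < 0 ->
  c = 2 * B0 A rho0 U10 U20 / A + ln (A / m1 r1 rho0 U10 ^ 2) ->
  b = m2 r1 U20 ^ 2 / A -> inverse_branch (-1) h ->
  let rs := r_s A r1 rho0 U10 U20 in
  0 < rs /\ 1 <= head c b rs /\
  total_mach2 A (branch_flow A (m1 r1 rho0 U10) (m2 r1 U20) c b (-1) h) rs = 1.
Proof.
  intros hA hr1 hrho0 hU hc hb hh rs.
  set (d := rho_s A rho0 U10 U20).
  set (m := m1 r1 rho0 U10); set (m' := m2 r1 U20).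
  assert (hm : m < 0).
  { unfold m, m1; assert (0 < r1 * rho0) by (apply Rmult_lt_0_compat; lra); nra. }
  assert (hd : 0 < d) by apply exp_pos.
  (* Bernoulli's law at density [rho_s] leaves kinetic energy [A / 2], the sonic value; the
     denominator in [r_s] thus reduces to [A * d ^ 2]. *)
  assert (hln : A * ln d = B0 A rho0 U10 U20 - A / 2).
  { unfold d, rho_s; rewrite ln_exp; field; lra. }
  assert (hX : 0 < (m ^ 2 + m' ^ 2 * d ^ 2) / (A * d ^ 2)).
  { apply Rdiv_lt_0_compat; [|apply Rmult_lt_0_compat; nra].
    assert (0 <= m' ^ 2 * d ^ 2) by (apply Rmult_le_pos; nra). nra. }
  assert (hrs : rs = sqrt ((m ^ 2 + m' ^ 2 * d ^ 2) / (A * d ^ 2))).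
  { unfold rs, r_s; fold d m m'; rewrite hln; do 2 f_equal; field. }
  assert (hrs0 : 0 < rs) by (rewrite hrs; apply sqrt_lt_R0; auto).
  assert (hrs2 : rs ^ 2 = (m ^ 2 + m' ^ 2 * d ^ 2) / (A * d ^ 2)).
  { rewrite hrs; apply pow2_sqrt; lra. }
  assert (hsum : (m / (rs * d)) ^ 2 + (m' / rs) ^ 2 = A).
  { transitivity ((m ^ 2 + m' ^ 2 * d ^ 2) / (d ^ 2 * rs ^ 2)); [field; lra|].
    rewrite hrs2; field; repeat split; nra. }
  assert (hu : m / (rs * d) < 0).
  { unfold Rdiv; assert (0 < / (rs * d)) by (apply Rinv_0_lt_compat; nra). nra. }
  assert (hphi : Phi (ln (mach2 A (m / (rs * d)))) = head c b rs).
  { rewrite hc, hb; apply (Phi_ln_mach2 A rs d _ (m' / rs)); auto;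
      [fold m; field; lra | fold m'; field; lra |].
    unfold bernoulli; rewrite hsum, hln; field. }
  assert (hmp := mach2_pos A _ hA hu).
  assert (hsum' : mach2 A (m / (rs * d)) + b / rs ^ 2 = 1).
  { rewrite hb; fold m'; unfold mach2.
    transitivity (((m / (rs * d)) ^ 2 + (m' / rs) ^ 2) / A); [field; lra|].
    rewrite hsum; field; lra. }
  assert (hb0 : 0 <= b / rs ^ 2).
  { rewrite hb; apply Rdiv_le_0_compat; [apply Rdiv_le_0_compat; nra | nra]. }
  split; [exact hrs0 | split].
  - rewrite <- hphi; apply Phi_ge1.
  - rewrite total_mach2_branch_flow by auto.
    (* The radial part of a total equal to 1 is at most 1, so the sonic state lies on the branch
       [e = -1]. Without rotation it is exactly 1, and the sonic circle is the limiting circle. *)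
    assert (hle : ln (mach2 A (m / (rs * d))) <= 0).
    { rewrite <- ln_1; destruct (Req_dec (mach2 A (m / (rs * d))) 1) as [->|]; [lra|].
      left; apply ln_increasing; lra. }
    rewrite <- hphi.
    replace (ln (mach2 A (m / (rs * d)))) with (-1 * - ln (mach2 A (m / (rs * d)))) by ring.
    rewrite (inverse_branch_unique (-1)) by (auto; lra).
    replace (-1 * - ln (mach2 A (m / (rs * d)))) with (ln (mach2 A (m / (rs * d)))) by ring.
    rewrite exp_ln by auto; exact hsum'.
Qed.

(** If the incoming radial Mach number were 1, [head] would reach its critical level 1 at [r1]
    itself; [hM1] excludes this. Choosing [rsharp] before [r0] makes it independent of the inner
    circle. *)
Theorem theorem2p2 (A r1 rho0 U10 U20 : R)
    (hA : 0 < A) (hr1 : 0 < r1) (hrho0 : 0 < rho0) (hU10 : U10 < 0)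
    (hM1 : mach2 A U10 <> 1) :
  exists rsharp : R,
    0 < rsharp < r1 /\
    (forall r0, 0 < r0 < rsharp ->
       ~ exists u, C1_solution A r1 rho0 U10 U20 r0 u) /\
    (forall r0, 0 < r0 < r1 -> rsharp <= r0 ->
       exists u, smooth_solution A r1 rho0 U10 U20 r0 u) /\
    (mach2 A U10 > 1 \/ (mach2 A U10 + mach2 A U20 > 1 /\ 1 > mach2 A U10) ->
       forall r0, 0 < r0 < r1 -> rsharp <= r0 ->
         exists_unique_smooth A r1 rho0 U10 U20 r0 (supersonic A r0 r1)) /\
    (mach2 A U10 + mach2 A U20 < 1 ->
       exists rs : R,
         rs = r_s A r1 rho0 U10 U20 /\
         0 < rs < r1 /\
         forall r0, 0 < r0 < r1 -> rsharp <= r0 ->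
           (r0 > rs ->
              exists_unique_smooth A r1 rho0 U10 U20 r0 (subsonic A r0 r1)) /\
           (r0 < rs ->
              exists_unique_smooth A r1 rho0 U10 U20 r0 (transonic A r0 r1)) /\
           (r0 = rs ->
              exists_unique_smooth A r1 rho0 U10 U20 r0
                (subsonic_sonic A r0 r1))).
Proof.
  remember (2 * B0 A rho0 U10 U20 / A + ln (A / m1 r1 rho0 U10 ^ 2)) as c eqn:hc.
  remember (m2 r1 U20 ^ 2 / A) as b eqn:hb.
  destruct (global_solution A r1 rho0 U10 U20 c b hA hr1 hrho0 hU10 hM1 hc hb)
    as [e [h [rsharp [he [hsign [hh [hrsharp [hhead [hend [hnone hglobal]]]]]]]]]].
  assert (hmp := mach2_pos A U10 hA hU10).
  assert (hb0 : 0 <= b) by (rewrite hb; apply Rdiv_le_0_compat; nra).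
  set (u := branch_flow A (m1 r1 rho0 U10) (m2 r1 U20) c b e h) in *.
  assert (hge : forall r, rsharp <= r -> 1 <= head c b r).
  { intros r hr; rewrite <- hhead; destruct (Req_dec rsharp r) as [->|]; [lra|].
    left; apply head_increasing; lra. }
  assert (hmach1 : total_mach2 A u r1 = mach2 A U10 + mach2 A U20).
  { unfold u; rewrite total_mach2_branch_flow, hend, exp_ln by auto; f_equal.
    rewrite hb; unfold mach2, m2; field; lra. }
  assert (hsub : mach2 A U10 < 1 -> e = -1).
  { intros hlt; destruct (sign_cases e he) as [-> | ->]; [exfalso | reflexivity].
    assert (ln (mach2 A U10) < ln 1) by (apply ln_increasing; lra).
    rewrite ln_1 in *; lra. }
  assert (hdecr : mach2 A U10 < 1 -> forall r s, rsharp <= r < s ->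
            total_mach2 A u s < total_mach2 A u r).
  { intros hlt r s hrs; unfold u; specialize (hsub hlt); subst e.
    apply total_mach2_decreasing; auto; [lra | apply hge; lra]. }
  exists rsharp; split; [exact hrsharp | split; [exact hnone | split; [|split]]].
  - intros r0 hr0 hr.
    destruct (hglobal r0 hr0 hr (fun _ => True) I) as [w [hw _]]; exists w; exact hw.
  - intros hcase r0 hr0 hr; apply hglobal; auto.
    (* For [e = 1] the radial part alone exceeds 1. For [e = -1] the total decreases outwards to its
       value at [r1], which already exceeds 1. *)
    intros r hrr; destruct hcase as [hsup | [htot hlt]].
    + assert (he1 : e = 1).
      { destruct (sign_cases e he) as [-> | ->]; [reflexivity | exfalso].
        assert (ln 1 < ln (mach2 A U10)) by (apply ln_increasing; lra).
        rewrite ln_1 in *; lra. }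
      assert (h1 : 1 < head c b r).
      { rewrite <- hhead; apply head_increasing; lra. }
      unfold u; rewrite total_mach2_branch_flow by (auto; lra).
      destruct (inverse_branch_derive e _ h he hh h1) as [_ [hd _]].
      assert (0 <= b / r ^ 2) by (apply Rdiv_le_0_compat; nra).
      rewrite he1 in *; lra.
    + assert (total_mach2 A u r1 < total_mach2 A u r) by (apply hdecr; lra). lra.
  - intros htot.
    assert (0 <= mach2 A U20) by (unfold mach2; apply Rdiv_le_0_compat; nra).
    assert (hlt : mach2 A U10 < 1) by lra.
    specialize (hdecr hlt).
    assert (hrs : let rs := r_s A r1 rho0 U10 U20 in
              0 < rs /\ 1 <= head c b rs /\ total_mach2 A u rs = 1).
    { unfold u; specialize (hsub hlt); subst e; apply sonic_radius; auto. }
    destruct hrs as [hrs0 [hrs1 hrs2]]; set (rs := r_s A r1 rho0 U10 U20) in *.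
    (* The sonic state satisfies the level equation, so [head] is at least 1 at [rs], whereas it is
       below 1 inside the limiting circle. *)
    assert (hsr : rsharp <= rs).
    { destruct (Rle_or_lt rsharp rs); auto; exfalso.
      assert (head c b rs < head c b rsharp) by (apply head_increasing; lra). lra. }
    assert (hrs3 : rs < r1).
    { destruct (Rtotal_order rs r1) as [l | [l | l]]; auto; exfalso.
      - rewrite l in hrs2; lra.
      - assert (total_mach2 A u rs < total_mach2 A u r1) by (apply hdecr; lra). lra. }
    assert (hafter : forall r, rs < r -> total_mach2 A u r < 1).
    { intros r hr; rewrite <- hrs2; apply hdecr; lra. }
    exists rs; split; [reflexivity | split; [lra|]].
    intros r0 hr0 hr; split; [|split]; intros hcmp; apply hglobal; auto.
    + intros r hrr; apply hafter; lra.
    + split.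
      * exists ((r0 + rs) / 2); split; [lra|].
        rewrite <- hrs2; apply hdecr; lra.
      * exists ((rs + r1) / 2); split; [lra|]. apply hafter; lra.
    + split; [intros r hrr; apply hafter; lra | rewrite hcmp; exact hrs2].
Qed.
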